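(* Let $\{A_n\}_n$ and $\{B_n\}_n$ be two sequences of matrices of increasing size, $A_n,B_n\in M_n(\mathbb C)$. Then $\{A_n-B_n\}_n$ converges to $\{O_n\}_n$ in Type 2 weak cluster sense if and only if $q_w(\{A_n-B_n\}_n)=0$.
   Context: $\|\cdot\|$ is the spectral norm and $O_n$ the $n\times n$ zero matrix. For a sequence $\{A_n\}_n$ with $A_n\in M_n(\mathbb C)$, $$q_w(\{A_n\}_n)=\inf\Big\{\limsup_{n\to\infty}\|N_n\| : R_n+N_n=A_n,\ \lim_{n\to\infty}\tfrac{\operatorname{rank}R_n}{n}=0\Big\},$$ the infimum being over all decompositions $\{A_n\}_n=\{R_n\}_n+\{N_n\}_n$ with $R_n,N_n\in M_n(\mathbb C)$. $\{A_n-B_n\}_n$ converges to $\{O_n\}_n$ in Type 2 weak cluster sense if for every $\epsilon>0$ there exist integers $n_{1,\epsilon}$ and $n_{2,\epsilon}$, where $n_{1,\epsilon}=n_{1,\epsilon}(n)$ may depend on both $n$ and $\epsilon$ and is $o(n)$ as $n\to\infty$, such that for all $n>n_{2,\epsilon}$ one has $A_n-B_n=R_n+N_n$ with $\operatorname{rank}R_n\le n_{1,\epsilon}$ and $\|N_n\|<\epsilon$. *)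

(* Defs.v *)
From mathcomp Require Import all_boot all_order all_algebra.
From mathcomp Require Import complex.
From mathcomp Require Import all_classical all_reals all_analysis.

Set Implicit Arguments.
Unset Strict Implicit.
Unset Printing Implicit Defensive.

Import Order.TTheory GRing.Theory Num.Theory.
Import numFieldNormedType.Exports.

Local Open Scope classical_set_scope.
Local Open Scope ring_scope.

(* [Normc.normc] is the complex modulus with values in [R]; the generic norm on
   [R[i]] takes its values in [R[i]]. *)
Definition eucl_norm (R : realType) (n : nat) (x : 'cV[R[i]]_n) : R :=
  Num.sqrt (\sum_(i < n) Normc.normc (x i 0) ^+ 2).

(* The operator norm induced by the Euclidean norm. The supremum is over the
   closed unit ball rather than the unit sphere, which is empty when [n = 0]. *)
Definition spectral_norm (R : realType) (n : nat) (A : 'M[R[i]]_n) : R :=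
  sup [set eucl_norm (A *m x) | x in [set x : 'cV[R[i]]_n | eucl_norm x <= 1]].

(* A sequence of matrices of increasing size; the [0 x 0] term is the only
   possible one and plays no role. *)
Definition mxseq (R : realType) := forall n : nat, 'M[R[i]]_n.

(* The limsup lies in [0, +oo], hence the infimum is taken in [\bar R]. *)
Definition q_w (R : realType) (A : mxseq R) : \bar R :=
  ereal_inf [set q : \bar R | exists Rs Ns : mxseq R,
    [/\ forall n, Rs n + Ns n = A n,
        (\rank (Rs n))%:R / n%:R @[n --> \oo] --> (0 : R) &
        q = limn_esup (fun n => (spectral_norm (Ns n))%:E)]].

(* [{A_n - B_n}_n] converges to [{O_n}_n] in Type 2 weak cluster sense. *)
Definition type2_weak_cluster (R : realType) (A B : mxseq R) : Prop :=
  forall eps : R, 0 < eps ->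
  exists (n1 : nat -> nat) (n2 : nat),
    (fun n => (n1 n)%:R : R^o) =o_\oo (fun n => n%:R : R^o) /\
    forall n, (n2 < n)%N -> exists Rn Nn : 'M[R[i]]_n,
      [/\ A n - B n = Rn + Nn,
          (\rank Rn <= n1 n)%N &
          spectral_norm Nn < eps].

(* Main.v *)
Require Import Defs.
From mathcomp Require Import all_boot all_order all_algebra.
From mathcomp Require Import complex.
From mathcomp Require Import all_classical all_reals all_analysis.

Local Open Scope ring_scope.

(** Both conditions say that, for each [eps > 0], the matrix [A n - B n] is,
    for all large [n], a sum [R_n + N_n] with [\rank R_n = o(n)] and
    [spectral_norm N_n < eps]; they differ only in how this is packaged.

    From the cluster decompositions to [q_w]: for a fixed [eps], the
    decompositions available for [n > n2] are completed by [R_n = A_n - B_n],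
    [N_n = 0] at the finitely many remaining indices. Neither the limit of
    [\rank R_n / n] nor the limsup of the norms sees these, so [q_w <= eps].
    Since [q_w] is an infimum, each [eps] may use its own decomposition, which
    avoids a diagonal extraction over [eps]. Together with [q_w >= 0]
    ([q_w_ge0]) this gives [q_w = 0].

    Conversely, [q_w < eps] provides one decomposition whose limsup is below
    [eps]; hence the norms themselves are eventually below [eps]
    ([limn_esup_lt_near]), and [n1 n := \rank (R_n)] is [o(n)]
    ([littleo_natE]).

    The only fact about the spectral norm that enters is that it is
    nonnegative. *)

Import Order.TTheory GRing.Theory Num.Theory.
Import numFieldNormedType.Exports.

Local Open Scope classical_set_scope.

Lemma limn_esup_le_near (R : realType) (u : (\bar R)^nat) (l : \bar R) :
  (\forall n \near \oo, (u n <= l)%E) -> (limn_esup u <= l)%E.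
Proof.
move=> ul; apply: ge_ereal_inf; exists (ereal_sup (u @` [set n | (u n <= l)%E])).
  by exists [set n | (u n <= l)%E].
by apply: ge_ereal_sup => _ [n unl <-].
Qed.

Lemma limn_esup_lt_near (R : realType) (u : (\bar R)^nat) (l : \bar R) :
  (limn_esup u < l)%E -> \forall n \near \oo, (u n < l)%E.
Proof.
move=> /ereal_inf_lt[_ [V nV <-] Vl].
apply: filterS nV => n Vn; apply: le_lt_trans Vl.
by apply: ereal_sup_ubound; exists n.
Qed.

(** At [n = 0] the quotient is a junk value, which the limit at infinity does
    not see. *)
Lemma littleo_natE (R : realType) (k : nat -> nat) :
  (fun n => (k n)%:R : R^o) =o_\oo (fun n => n%:R : R^o) <->
  (k n)%:R / n%:R @[n --> \oo] --> (0 : R).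
Proof.
have ratio_le (eps : R) n : (0 < n)%N ->
    (`|(k n)%:R / n%:R| <= eps) = (`|(k n)%:R : R^o| <= eps * `|n%:R : R^o|).
  by move=> n0; rewrite normrM normfV ler_pdivrMr// normr_gt0 pnatr_eq0 -lt0n.
split=> [/eqoP ko|k0].
  apply/cvgr0Pnorm_le => eps eps0; near=> n.
  rewrite ratio_le; last by near: n; exact: nbhs_infty_gt.
  by near: n; exact: ko.
apply/eqoP => eps eps0; near=> n.
rewrite -ratio_le; last by near: n; exact: nbhs_infty_gt.
by near: n; move: eps eps0; apply/cvgr0Pnorm_le.
Unshelve. all: by end_near. Qed.

Lemma eucl_norm_ge0 (R : realType) (n : nat) (x : 'cV[R[i]]_n) :
  0 <= eucl_norm x.
Proof. exact: sqrtr_ge0. Qed.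

(** A supremum of nonnegative reals is nonnegative whether or not they are
    bounded, since [sup] is [0] on unbounded sets. *)
Lemma spectral_norm_ge0 (R : realType) (n : nat) (A : 'M[R[i]]_n) :
  0 <= spectral_norm A.
Proof.
rewrite /spectral_norm; set E := [set _ | _ in _].
have [supE|/sup_out->//] := pselect (has_sup E).
have [[r Er] _] := supE; apply: le_trans (sup_upper_bound supE Er).
by case: Er => x _ <-; exact: eucl_norm_ge0.
Qed.

Lemma q_w_ge0 (R : realType) (A : mxseq R) : (0 <= q_w A)%E.
Proof.
apply: le_ereal_inf_tmp => _ [Rs [Ns [_ _ ->]]].
apply: limf_esup_ge0 => [|n]; first exact: filter_not_empty.
by rewrite lee_fin spectral_norm_ge0.
Qed.

(** A decomposition has to be given at every index, whereas the hypothesis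
    concerns large ones only; the others are absorbed by the low-rank part. *)
Lemma q_w_le_near (R : realType) (A : mxseq R) (eps : R) (k : nat -> nat)
    (m : nat) :
  (k n)%:R / n%:R @[n --> \oo] --> (0 : R) ->
  (forall n, (m < n)%N -> exists Rn Nn : 'M[R[i]]_n,
    [/\ A n = Rn + Nn, (\rank Rn <= k n)%N & spectral_norm Nn < eps]) ->
  (q_w A <= eps%:E)%E.
Proof.
move=> k0 dec.
have total_dec n : exists RN : 'M[R[i]]_n * 'M[R[i]]_n,
    RN.1 + RN.2 = A n /\
    ((m < n)%N -> (\rank RN.1 <= k n)%N /\ spectral_norm RN.2 < eps).
  have [mn|nm] := ltnP m n; last by exists (A n, 0); rewrite addr0.
  by have [Rn [Nn [-> rk nrm]]] := dec n mn; exists (Rn, Nn).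
have [D DP] := all_sig (fun n => cid (total_dec n)).
apply: ge_ereal_inf.
exists (limn_esup (fun n => (spectral_norm (D n).2)%:E)).
  exists (fun n => (D n).1), (fun n => (D n).2).
  split=> [n|//|//]; first by have [] := DP n.
  apply: squeeze_cvgr (cvg_cst 0) k0; near=> n.
  have [_ /(_ _)[|rk _]] := DP n; first by near: n; exact: nbhs_infty_gt.
  by rewrite divr_ge0//= ler_wpM2r ?invr_ge0// ler_nat.
apply: limn_esup_le_near; near=> n.
have [_ /(_ _)[|_ nrm]] := DP n; first by near: n; exact: nbhs_infty_gt.
by rewrite lee_fin ltW.
Unshelve. all: by end_near. Qed.

Theorem corollary2p9 (R : realType) (A B : forall n : nat, 'M[R[i]]_n) :
  type2_weak_cluster A B <-> q_w (fun n => A n - B n) = 0%E.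
Proof.
split=> [cl|q0 eps eps0].
  apply/eqP; rewrite eq_le q_w_ge0 andbT; apply/lee_addgt0Pr => eps eps0.
  have [n1 [n2 [/littleo_natE n1o dec]]] := cl eps eps0.
  by rewrite add0e; exact: q_w_le_near n1o dec.
have : (q_w (fun n => A n - B n)%R < eps%:E)%E by rewrite q0 lte_fin.
case/ereal_inf_lt => _ [Rs [Ns [ABE rk0 ->]]] /limn_esup_lt_near[n2 _ Nlt].
exists (fun n => \rank (Rs n)), n2; split; first exact/littleo_natE.
move=> n n2n; exists (Rs n), (Ns n); split=> //.
by rewrite -lte_fin; apply: Nlt; exact: ltnW.
Qed.
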